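(* Let $N\in\mathbb{N}$. (i) Let $1\le s\le N$, and let $g_{s,N}$ be the largest value of $r(S)$ over all subsets $S\subseteq[1,N]$ with $|S|=s$. Then $g_{s,N}=\frac{s(s-1)}{2}$. (ii) For a subset $S=\{x_1<x_2<\cdots<x_s\}\subseteq[1,N]$ of size $s$ (with $1\le s\le N$), $r(S)=g_{s,N}$ if and only if $S$ is an arithmetic progression with common difference equal to $x_1$, i.e. $S=\{x_1,2x_1,\ldots,sx_1\}$.
   Context: $\mathbb{N}$ denotes the positive integers. For integers $a\le b$, $[a,b]$ denotes the set of integers $x$ with $a\le x\le b$. For a finite set $S\subseteq\mathbb{N}$, $r(S)=|\{(x,y)\in S^2: x+y\in S\}|$ (ordered pairs, $x=y$ allowed). *)

(* Defs.v *)
From mathcomp Require Import all_boot.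
From mathcomp Require Import finmap.

Set Implicit Arguments.
Unset Strict Implicit.
Unset Printing Implicit Defensive.

Local Open Scope fset_scope.
Local Open Scope nat_scope.

Definition interval (a b : nat) : {fset nat} :=
  [fset x in iota a (b.+1 - a)].

Definition r (S : {fset nat}) : nat :=
  #|` [fset p in S `*` S | p.1 + p.2 \in S] |.

(* For s <= N the family is nonempty, so \max (which is 0 on an empty range)
   is an attained maximum. *)
Definition g (s N : nat) : nat :=
  \max_(S <- fpowerset (interval 1 N) | #|` S| == s) r S.

Definition arithmetic_progression (d : nat) (S : {fset nat}) : Prop :=
  exists a : nat, S = [fset a + i * d | i in iota 0 #|` S|].

(* Main.v *)
Require Import Defs.
From mathcomp Require Import all_boot.
From mathcomp Require Import finmap.
From mathcomp Require Import zify.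

Local Open Scope fset_scope.
Local Open Scope nat_scope.

(** If [m] is larger than every element of a set [S] of positive integers, then
    in [S] with [m] added the new pairs are exactly the [(x, m - x)] with both
    entries in [S], so [r] grows by at most [|S|].  Summing these increments
    gives the bound [s (s - 1) / 2].  Equality forces [m - x] into [S] for all
    [x] in [S]; if [S = {d, 2d, ..., sd}], taking [x = d] makes [m] a multiple
    of [d] with [m - d <= sd < m], that is [m = (s + 1) d]. *)

(** Induction on a strict upper bound of the set: lowering it from [n.+1] to [n] costs at most the
    element [n], which is then the maximum. *)
Lemma fset_nat_max_ind (P : {fset nat} -> Prop) :
  P fset0 ->
  (forall m (S : {fset nat}), (forall y, y \in S -> y < m) -> P S -> P (m |` S)) ->
  forall S, P S.
Proof.
move=> P0 PU.
suff bounded n : forall S : {fset nat}, (forall y, y \in S -> y < n) -> P S.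
  move=> S; apply: (bounded (\max_(y <- S) y).+1) => y yS.
  exact: (@leq_bigmax_seq _ (enum_fset S) xpredT id).
elim: n => [|n IHn] S ltSn.
  suff -> : S = fset0 by [].
  by apply/fsetP => y; rewrite in_fset0; apply/negP => /ltSn.
have ltSDn y : y \in S `\ n -> y < n.
  by rewrite in_fsetD1 => /andP[? /ltSn]; lia.
have [nS|nNS] := boolP (n \in S).
  by rewrite -(fsetD1K nS); apply: PU => //; apply: IHn.
apply: IHn => y yS; have := ltSn _ yS.
by rewrite ltnS leq_eqVlt => /predU1P[yn|//]; rewrite -yn yS in nNS.
Qed.

Lemma r_fset0 : r fset0 = 0.
Proof.
apply/eqP; rewrite cardfs_eq0; apply/eqP/fsetP => p.
by rewrite !inE /=.
Qed.

(** By positivity, a pair with an entry [m] has sum above [m], hence outside the set. So a new pair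
    has entries in [S] and sum [m], and its first entry determines it. *)
Lemma r_fsetU1 (m : nat) (S : {fset nat}) :
  0 \notin m |` S -> (forall y, y \in S -> y < m) ->
  r (m |` S) = r S + #|` [fset y in S | m - y \in S]|.
Proof.
rewrite in_fset1U negb_or => /andP[m_neq0 S0] ltSm.
have gt0 y : y \in S -> 0 < y by case: y => // yS; rewrite yS in S0.
pose new := [fset (y, m - y) | y in [fset y in S | m - y \in S]].
have -> : #|` [fset y in S | m - y \in S]| = #|` new|.
  by apply/esym/card_imfset => y z [].
have newP y z : ((y, z) \in new) = [&& y \in S, z \in S & y + z == m].
  apply/imfsetP/and3P => /= [[t]|[yS zS /eqP yz]].
    rewrite !inE /= => /andP[tS mtS] [-> ->]; split=> //.
    by have := ltSm _ tS; lia.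
  have -> : z = m - y by lia.
  by exists y => //; rewrite !inE /= yS (_ : m - y = z) //; lia.
(* Old pairs have their sum in [S], hence below [m], so they are disjoint from [new] and the
   intersection term vanishes. *)
rewrite /r -cardfsUI [X in _ = _ + #|` X|](_ : _ = fset0) ?cardfs0 ?addn0.
  congr (#|` _|); apply/fsetP => -[y z].
  rewrite in_fsetU newP !inE /=.
  have [yS|yNS] := boolP (y \in S); have [zS|zNS] := boolP (z \in S);
    rewrite ?orbT ?orbF ?andbT /=.
  - exact: orbC.
  - apply/negP => /andP[/eqP zm /orP[/eqP|/ltSm]]; have := gt0 _ yS; lia.
  - apply/negP => /andP[/eqP zm /orP[/eqP|/ltSm]]; have := gt0 _ zS; lia.
  - apply/negP => /andP[/andP[/eqP ym /eqP zm] /orP[/eqP|/ltSm]]; lia.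
apply/fsetP => -[y z]; rewrite in_fsetI newP !inE /=.
apply/negP => /andP[/andP[_ /ltSm yzm] /and3P[_ _ /eqP]]; lia.
Qed.

Definition multiples (d s : nat) : {fset nat} :=
  [fset i * d | i in interval 1 s].

Lemma mem_interval (a b i : nat) : (i \in interval a b) = (a <= i <= b).
Proof. by rewrite !inE /= mem_iota; lia. Qed.

Lemma multiplesP (d s y : nat) :
  reflect (exists2 i, 1 <= i <= s & y = i * d) (y \in multiples d s).
Proof.
by apply: (iffP (imfsetP _ _ _ _)) => -[i /= i_s ->]; exists i;
  rewrite //= ?mem_interval // -mem_interval.
Qed.

Lemma multiples0 (d : nat) : multiples d 0 = fset0.
Proof.
by apply/fsetP => y; rewrite in_fset0; apply/multiplesP => -[i]; lia.
Qed.

Lemma multiplesS (d s : nat) : multiples d s.+1 = s.+1 * d |` multiples d s.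
Proof.
apply/fsetP => y; rewrite in_fset1U; apply/multiplesP/predU1P.
  move=> [i i_s ->]; have [->|i_neq] := eqVneq i s.+1; first by left.
  by right; apply/multiplesP; exists i => //; lia.
move=> [->|/multiplesP[i i_s ->]]; first by exists s.+1 => //; lia.
by exists i => //; lia.
Qed.

Lemma multiples1 (s : nat) : multiples 1 s = interval 1 s.
Proof.
apply/fsetP => y; rewrite mem_interval; apply/multiplesP/idP.
  by move=> [i ? ->]; rewrite muln1.
by exists y; rewrite ?muln1.
Qed.

(** Shifts the index to start at 0, as in [arithmetic_progression]; the initial term is then [d]
    itself. *)
Lemma multiples_iota (d s : nat) :
  multiples d s = [fset d + i * d | i in iota 0 s].
Proof.
apply/fsetP => y; apply/multiplesP/imfsetP => -[i /=].
  by move=> i_s ->; exists i.-1; rewrite /= ?mem_iota; first lia; case: i i_s.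
by rewrite mem_iota => i_s ->; exists i.+1; rewrite ?mulSn //; lia.
Qed.

Lemma multiples_lt (d s : nat) : 0 < d ->
  forall y, y \in multiples d s -> y < s.+1 * d.
Proof. by move=> d0 y /multiplesP[i i_s ->]; rewrite ltn_pmul2r; lia. Qed.

Lemma card_multiples (d s : nat) : 0 < d -> #|` multiples d s| = s.
Proof.
move=> d0; elim: s => [|s IHs]; first by rewrite multiples0 cardfs0.
rewrite multiplesS cardfsU1 IHs.
by case: (boolP (_ \in _)) => [/(multiples_lt _ _ d0)|_ //]; rewrite ltnn.
Qed.

Lemma multiples_neq0 (d s : nat) : 0 < d -> 0 \notin multiples d s.
Proof. by move=> d0; apply/multiplesP => -[i]; nia. Qed.

(** The reflection sending [y] to [s.+1 * d - y] maps [multiples d s] to itself, so adding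
    [s.+1 * d] creates exactly [s] new pairs. *)
Lemma r_multiples (d s : nat) : 0 < d -> r (multiples d s) = 'C(s, 2).
Proof.
move=> d0; elim: s => [|s IHs]; first by rewrite multiples0 r_fset0.
have := multiples_neq0 _ s.+1 d0.
rewrite multiplesS => pos; rewrite r_fsetU1 //; last exact: multiples_lt.
rewrite IHs binS bin1; congr (_ + _).
rewrite -[RHS](card_multiples d) //; congr (#|` _|).
apply/fsetP => y; rewrite !inE /=; case: multiplesP => // -[i i_s ->] /=.
by apply/multiplesP; exists (s.+1 - i); rewrite ?mulnBl //; lia.
Qed.

Lemma r_leq (S : {fset nat}) : 0 \notin S -> r S <= 'C(#|` S|, 2).
Proof.
elim/fset_nat_max_ind: S => [|m S ltSm IHS] pos; first by rewrite r_fset0.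
have mNS : m \notin S by apply/negP => /ltSm; rewrite ltnn.
rewrite r_fsetU1 // cardfsU1 mNS binS bin1 leq_add //.
  by apply: IHS; move: pos; rewrite in_fset1U negb_or => /andP[].
by apply/fsubset_leq_card/fsubsetP => y; rewrite !inE /= => /andP[].
Qed.

Lemma r_eq_bin2 (S : {fset nat}) : 0 \notin S -> r S = 'C(#|` S|, 2) ->
  exists2 d, 0 < d & S = multiples d #|` S|.
Proof.
elim/fset_nat_max_ind: S => [|m S ltSm IHS] pos.
  by exists 1 => //; rewrite cardfs0 multiples0.
have mNS : m \notin S by apply/negP => /ltSm; rewrite ltnn.
have [m_neq0 S0] : m != 0 /\ 0 \notin S.
  by move: pos; rewrite in_fset1U negb_or eq_sym => /andP[].
rewrite r_fsetU1 // cardfsU1 mNS binS bin1 add1n.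
have subS : [fset y in S | m - y \in S] `<=` S.
  by apply/fsubsetP => y; rewrite !inE /= => /andP[].
have := fsubset_leq_card subS; have := r_leq S S0 => rS cardS r_eq.
(* The bounds [rS] and [cardS] add up to the value in [r_eq], so both are equalities: one feeds the
   induction hypothesis, the other gives [reflS]. *)
have [d d0 SE] : exists2 d, 0 < d & S = multiples d #|` S| by apply: IHS; lia.
have /eqP reflS : [fset y in S | m - y \in S] == S.
  by rewrite eqEfcard subS; lia.
(* For empty [S] the [d] obtained by induction is arbitrary; the difference must be [m] itself. *)
case: (posnP #|` S|) => [S_0|S_gt0].
  exists m; first by rewrite lt0n.
  by rewrite S_0 multiplesS mul1n SE S_0 !multiples0.
exists d => //; rewrite multiplesS -SE; congr (_ |` _).
have dS : d \in S.
  by rewrite SE; apply/multiplesP; exists 1; rewrite ?mul1n //; lia.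
have sdS : #|` S| * d \in S.
  by rewrite SE; apply/multiplesP; exists #|` S|; rewrite -?SE //; lia.
have : m - d \in S by move: dS; rewrite -{1}reflS !inE /= => /andP[].
rewrite {1}SE => /multiplesP[i i_s mE].
(* Subtraction truncates, so [d < m] is used to recover [m] from [m - d]. *)
have mi : m = i.+1 * d by have := ltSm _ dS; lia.
have := ltSm _ sdS; rewrite mi ltn_pmul2r // => s_i.
by congr (_ * _); lia.
Qed.

Lemma interval1_pos (N : nat) (S : {fset nat}) :
  S `<=` interval 1 N -> 0 \notin S.
Proof. by move=> /fsubsetP sub; apply/negP => /sub; rewrite mem_interval. Qed.

Lemma gE (s N : nat) : s <= N -> g s N = 'C(s, 2).
Proof.
move=> sN; apply/eqP; rewrite eqn_leq; apply/andP; split.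
  apply/bigmax_leqP_seq => S; rewrite fpowersetE => /interval1_pos pos /eqP <-.
  exact: r_leq.
(* The bound is attained at [multiples 1 s], the interval from 1 to [s]. *)
rewrite -(r_multiples 1) // /g; apply: leq_bigmax_seq.
  rewrite fpowersetE multiples1; apply/fsubsetP => y.
  by rewrite !mem_interval; lia.
by rewrite card_multiples.
Qed.

(** The definition leaves the initial term [a] free. As [S] is nonempty, [a] is its least element,
    which forces [a = d]. *)
Lemma arithmetic_progression_minP (d : nat) (S : {fset nat}) :
  d \in S -> (forall y, y \in S -> d <= y) ->
  arithmetic_progression d S <-> S = multiples d #|` S|.
Proof.
move=> dS minS; rewrite multiples_iota; split=> [[a SE]|SE]; last by exists d.
suff ad : a = d by rewrite ad in SE.
apply/eqP; rewrite eqn_leq; apply/andP; split.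
  by move: dS; rewrite SE => /imfsetP[i _ ->]; rewrite leq_addr.
apply: minS; rewrite SE; apply/imfsetP; exists 0; rewrite /= ?addn0 //.
by rewrite mem_iota /= add0n cardfs_gt0; apply/fset0Pn; exists d.
Qed.

Theorem theorem3p1 (N : nat) (hN : 0 < N) :
  (forall s : nat, 1 <= s <= N -> g s N = (s * (s - 1)) %/ 2)
  /\
  (forall (s : nat) (S : {fset nat}) (x : nat -> nat),
     1 <= s <= N ->
     S `<=` interval 1 N ->
     #|` S| = s ->
     (forall i j : nat, 1 <= i -> i < j -> j <= s -> x i < x j) ->
     S = [fset x i | i in interval 1 s] ->
     (r S = g s N <-> arithmetic_progression (x 1) S)
     /\ (arithmetic_progression (x 1) S
         <-> S = [fset i * x 1 | i in interval 1 s])).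
Proof.
split=> [s /andP[_ sN]|s S x /andP[s_gt0 sN] /interval1_pos pos cardS x_incr SE].
  by rewrite gE // bin2 divn2 subn1.
have x1S : x 1 \in S.
  by rewrite SE; apply/imfsetP; exists 1; rewrite //= mem_interval.
have x1_min y : y \in S -> x 1 <= y.
  rewrite SE => /imfsetP[i /=]; rewrite mem_interval => /andP[i1 i_s] ->.
  by move: i1; rewrite leq_eqVlt => /predU1P[<-//|i1]; apply/ltnW/x_incr.
have x1_gt0 : 0 < x 1 by rewrite lt0n; apply: contraNneq pos => <-.
have APP := arithmetic_progression_minP _ _ x1S x1_min.
rewrite cardS in APP; split=> //; rewrite gE //; split=> [rS|/APP ->].
  apply/APP; rewrite -cardS in rS.
  have [d d0 SdE] := r_eq_bin2 _ pos rS; rewrite cardS in SdE.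
  (* Both are the minimum of [S]: [d] lies in [S], and [x 1] is a positive multiple of [d]. *)
  suff -> : x 1 = d by [].
  apply/eqP; rewrite eqn_leq x1_min /=; last first.
    by rewrite SdE; apply/multiplesP; exists 1; rewrite ?mul1n.
  by move: x1S; rewrite SdE => /multiplesP[i /andP[i1 _] ->]; rewrite leq_pmull.
exact: r_multiples.
Qed.
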